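(* Let $\alpha_{n_1n_2\dots n_k}$ ($0\le n_i\le3$, $n_k\ne0$) be a periodic direction with pair of Roman periods $(a,A)$, $a\le A$. Then its period $a+\phi A\in\mathbb{Z}[\phi]$ is the first component of the vector $$X_{n_k}X_{n_{k-1}}\cdots X_{n_1}\begin{pmatrix}\phi^2\\ \phi^2\end{pmatrix},$$ where $$X_0=\begin{pmatrix}1&0\\ \phi&1\end{pmatrix},\quad X_1=\begin{pmatrix}\phi&1\\ \phi&\phi\end{pmatrix},\quad X_2=\begin{pmatrix}\phi&\phi\\ 1&\phi\end{pmatrix},\quad X_3=\begin{pmatrix}1&\phi\\ 0&1\end{pmatrix}.$$
   Context: Let $\phi=\frac{1+\sqrt5}{2}$. Let $P$ be a regular plane pentagon of side $1$ with a horizontal side at the bottom; label its sides, counterclockwise starting from the bottom side, by $3,5,2,4,1$. Let $P'=-P$ be its centrally symmetric copy; the side of $P'$ parallel to side $i$ of $P$ is also labelled $i$. The double pentagon $X$ is the flat surface obtained from $P\sqcup P'$ by gluing, for each $i$, the two sides labelled $i$ by a parallel translation. Directions of linear trajectories on $X$ are considered modulo $180^\circ$. The direction making angle $\theta$ (counterclockwise) with the horizontal is identified with the point $x=-\sin 36^\circ\cot\theta\in\mathbb{R}\cup\{\infty\}$. The 3rd sector is $72^\circ\le\theta\le108^\circ$, i.e. $\frac{\phi}{2}-1\le x\le 1-\frac{\phi}{2}$. Regard $\mathbb{R}\cup\{\infty\}$ as the boundary at infinity of the hyperbolic plane. The ideal pentagon of generation $0$ has vertices $1-\frac{\phi}{2},\frac{\phi}{2},\infty,-\frac{\phi}{2},\frac{\phi}{2}-1$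 (in cyclic order). The pentagons of generation $k+1$ are obtained from those of generation $k$ by reflecting each of them in its sides (for $k\ge1$, in its four sides not shared with a pentagon of generation $k-1$). The vertices in the 3rd sector are labelled recursively: put $\alpha=1-\frac{\phi}{2}$ (the case $k=0$) and let $I_\emptyset$ be the arc from $\alpha$ down to $\frac{\phi}{2}-1$. Given an arc $I_{n_1\dots n_k}$ whose endpoints span a side of a pentagon of generation $k$, the pentagon of generation $k+1$ across this side has vertices $v_0>v_1>v_2>v_3>v_4$ with $v_0,v_4$ the endpoints of the arc; set $\alpha_{n_1\dots n_k m}=v_m$ and let $I_{n_1\dots n_k m}$ be the arc from $v_m$ to $v_{m+1}$, $0\le m\le3$ (so $\alpha_{n_1\dots n_k0}=\alpha_{n_1\dots n_k}$, and trailing zeros are dropped). These points are periodic directions: for such a direction $X$ decomposes into two strips of parallel closed trajectories. The symbolic orbit of a closed trajectory is the cyclic word in $1,\dots,5$ formed by the labels of the sides consecutively crossed in one traversal; it is the same for all trajectories of one strip. For directions in the 3rd sector it splits into consecutive two-letter blocks from $43,41,25,23$, and the Roman period is the number of such blocks (half the length of the word). The pair $(a,A)$ of Roman periods of a direction consists of the Roman periods of its two strips. *)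

(* Defs.v *)
(* The real numbers are an arbitrary [R : realType]. *)
From mathcomp Require Import all_boot all_order all_algebra.
From mathcomp Require Import all_classical all_reals all_analysis.

Set Implicit Arguments.
Unset Strict Implicit.
Unset Printing Implicit Defensive.

Import Order.TTheory GRing.Theory Num.Theory.
Import numFieldNormedType.Exports.

Local Open Scope classical_set_scope.
Local Open Scope ring_scope.

Definition phi (R : realType) : R := (1 + Num.sqrt 5) / 2.

(** ** The double pentagon *)

(* [false] stands for P and [true] for P' = -P.  P is centred at the origin;
   its vertices 0, ..., 4 are listed counterclockwise from the bottom left one,
   and side k joins vertex k to vertex k+1 (indices are periodic mod 5).  The
   circumradius 1 / (2 sin 36°) gives sides of length 1. *)
Definition vertex (R : realType) (b : bool) (k : nat) : R * R :=
  let r := (-1) ^+ b / (2 * sin (pi / 5)) in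
  let t := 2 * pi * k%:R / 5 - 7 * pi / 10 in
  (r * cos t, r * sin t).

(* Side k of P' is the opposite of side k of P, hence parallel to it, so the
   two carry the same label. *)
Definition label (k : 'I_5) : nat := nth 0%N [:: 3; 5; 2; 4; 1]%N k.

Definition on_open_side (R : realType) (b : bool) (k : 'I_5) (p : R * R) :
    Prop :=
  exists t : R, 0 < t < 1 /\
    p = ((1 - t) * (vertex R b k).1 + t * (vertex R b k.+1).1,
         (1 - t) * (vertex R b k).2 + t * (vertex R b k.+1).2).

(* The translation carrying side k of polygon b to side k of the other polygon:
   it maps vertex k to the opposite of vertex k+1, and conversely. *)
Definition glue (R : realType) (b : bool) (k : 'I_5) (p : R * R) : R * R :=
  p - vertex R b k - vertex R b k.+1.

(** ** Closed trajectories *)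

(* [(b, k, p)]: the trajectory leaves polygon b at the point p of its side k. *)
Notation crossing R := (bool * 'I_5 * (R * R))%type.

(* [c'] is the crossing that follows [c] on a trajectory of direction theta:
   after c the trajectory enters the other polygon through side k, at the point
   glued to p, and runs in the direction (cos theta, sin theta) until it leaves
   through side k'.  As the pentagons are convex, [k' != k] says that the piece
   between the two points lies inside the polygon and not along a side. *)
Definition next_crossing (R : realType) (theta : R) : rel (crossing R) :=
  fun c c' =>
    let: (b, k, p) := c in let: (b', k', p') := c' in
    let q := glue b k p in
    `[< [/\ b' = ~~ b, k' != k, on_open_side b k p, on_open_side b' k' p'
          & exists2 s : R, 0 < s & p' = (q.1 + s * cos theta,
                                         q.2 + s * sin theta)] >].

(* A closed trajectory is given by its successive crossings, from an arbitrary
   starting one, in a single traversal: this is why they are distinct. *)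
Definition closed_trajectory (R : realType) (theta : R) (s : seq (crossing R)) :
    Prop :=
  s <> [::] /\ ucycle (next_crossing theta) s.

Definition symbolic_orbit (R : realType) (s : seq (crossing R)) : seq nat :=
  [seq label c.1.2 | c <- s].

(* Continuous deformation through closed trajectories of direction theta.  The
   crossing points move continuously in the disjoint union of the open sides,
   hence never change sides. *)
Definition deforms_to (R : realType) (theta : R) (s s' : seq (crossing R)) :
    Prop :=
  exists f : R -> seq (crossing R),
    [/\ f 0 = s, f 1 = s',
        forall t : R, 0 <= t <= 1 ->
          closed_trajectory theta (f t) /\ map fst (f t) = map fst s
      & forall i : nat,
          {within `[0, 1], continuous (fun t : R => (map snd (f t))`_i)}].

(* A strip is a maximal connected family of parallel closed trajectories; the
   rotation accounts for the choice of the starting crossing. *)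
Definition same_strip (R : realType) (theta : R) (s s' : seq (crossing R)) :
    Prop :=
  exists i : nat, deforms_to theta s (rot i s').

(** ** Roman periods *)

Definition blocks : seq (seq nat) :=
  [:: [:: 4; 3]; [:: 4; 1]; [:: 2; 5]; [:: 2; 3]]%N.

Definition has_roman_period (w : seq nat) (N : nat) : Prop :=
  exists bs : seq (seq nat),
    [/\ {subset bs <= blocks}, size bs = N
      & exists i : nat, rot i w = flatten bs].

(* The strips of direction theta are exactly two, the strip of s1, of Roman
   period a, and that of s2, of Roman period A. *)
Definition roman_periods (R : realType) (theta : R) (a A : nat) : Prop :=
  exists s1 s2 : seq (crossing R),
    [/\ closed_trajectory theta s1 /\ closed_trajectory theta s2,
        ~ same_strip theta s1 s2,
        forall s, closed_trajectory theta s ->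
          same_strip theta s s1 \/ same_strip theta s s2,
        has_roman_period (symbolic_orbit s1) a
      & has_roman_period (symbolic_orbit s2) A].

(** ** Directions and their labels *)

(* For 0 < theta < pi, i.e. for all directions except the horizontal one, which
   corresponds to the point at infinity. *)
Definition direction_point (R : realType) (theta : R) : R :=
  - (sin (pi / 5) * (cos theta / sin theta)).

(* The boundary of the hyperbolic plane is [option R], with [None] for the
   point at infinity.  [reflect_in u v] is the action on this boundary of the
   reflection in the geodesic with endpoints u and v, that is of the inversion
   in the circle with diameter [v, u]. *)
Definition reflect_in (R : realType) (u v : R) (z : option R) : option R :=
  let c := (u + v) / 2 in
  match z with
  | None => Some c
  | Some x => if x == c then None else Some (c + ((u - v) / 2) ^+ 2 / (x - c))
  end.

(* The list v_0 > ... > v_4 of vertices of the image of an ideal pentagon by the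
   reflection in its side uv.  Inside the arcs used below all five vertices of
   the image are finite, so that [pmap] drops nothing. *)
Definition pentagon_across (R : realType) (pent : seq (option R)) (u v : R) :
    seq R :=
  sort >=%O (pmap (reflect_in u v) pent).

Definition pentagon0 (R : realType) : seq (option R) :=
  [:: Some (1 - phi R / 2); Some (phi R / 2); None;
      Some (- (phi R / 2)); Some (phi R / 2 - 1)].

(* [pent] is a pentagon of generation k with a side spanned by the endpoints
   u > v of the arc I_{n_1 ... n_k}; [n] is what remains of the label.  The value
   is the upper endpoint of the arc reached, i.e. the labelled point. *)
Fixpoint descend (R : realType) (pent : seq (option R)) (u v : R)
    (n : seq 'I_4) : R :=
  match n with
  | [::] => u
  | m :: n' => let w := pentagon_across pent u v in
               descend (map Some w) w`_m w`_m.+1 n'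
  end.

Definition alpha (R : realType) (n : seq 'I_4) : R :=
  descend (pentagon0 R) (1 - phi R / 2) (phi R / 2 - 1) n.

(** ** The matrices *)

Definition mx_of_rows (R : realType) (rows : seq (seq R)) : 'M[R]_2 :=
  \matrix_(i < 2, j < 2) (nth [::] rows i)`_j.

Definition Xmat (R : realType) (m : 'I_4) : 'M[R]_2 :=
  let f := phi R in
  nth 0 [:: mx_of_rows [:: [:: 1; 0]; [:: f; 1]];
            mx_of_rows [:: [:: f; 1]; [:: f; f]];
            mx_of_rows [:: [:: f; f]; [:: 1; f]];
            mx_of_rows [:: [:: 1; f]; [:: 0; 1]]] m.

(* Main.v *)
Require Import Defs.
From mathcomp Require Import all_boot all_order all_algebra.
From mathcomp Require Import all_classical all_reals all_analysis.
From mathcomp Require Import ring lra zify.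

Import Order.TTheory GRing.Theory Num.Theory.
Local Open Scope ring_scope.

(** Write [(u, w)] for the first row of [X_{n_k} ... X_{n_1}]; the right-hand
    side of the theorem is then [phi^2 (u + w)].

    Directions.  Each ideal pentagon met on the way to [alpha n] is spanned by
    one of its sides, with endpoints x > y carrying positive weights s and t, as
    the points of weights (s, 0), (phi s, -t), (s, -t), (s, -phi t), (0, t).  The
    reflection in the side changes the sign of the second weight, and taking a
    side of the image as the new base multiplies the weights by [X_m] transposed.
    Hence [alpha n = (1 - phi/2) (u - w) / (u + w)] ([alphaE]).

    Trajectories.  In the corresponding direction, the first return of the flow
    to the long horizontal diagonal of P is an exchange of four intervals, one
    for each of the blocks 43, 41, 25, 23.  In a suitable unit the diagonal has
    length [phi^2 (u + w)], and the four intervals have lengths phi u, w, u and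
    phi w.  This exchange is self-similar: if [(u, w) = (u', w') X_m], then the
    exchange of (u, w) induces on a subinterval of length [phi^2 (u' + w')] a
    translate of the exchange of (u', w') ([renorm_block]).  For (1, 0) the
    exchange is the identity, and a point of each of the intervals 43 and 25 is a
    closed orbit.  Going back up along the label n yields two closed orbits, of
    which the numbers of visits to each interval are known: they express that the
    four intervals are cut into cells of length 1, visited by the first orbit, and
    cells of length phi, visited by the second ([census], [two_orbits]).  Adding
    the four lengths, the numbers of blocks N1 and N2 of the two orbits satisfy
    [N1 + phi N2 = phi^2 (u + w)], and N1 <= N2.

    Conclusion.  An orbit of the exchange is realised by a closed trajectory on
    the surface ([closed_orbit_trajectory]).  The two trajectories obtained cross
    the sides with different multiplicities, so they lie in different strips,
    and their periods N1 and N2 are a and A. *)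

(** * Generalities *)

Lemma ord4P (P : 'I_4 -> Prop) :
  P (inord 0) -> P (inord 1) -> P (inord 2) -> P (inord 3) -> forall m, P m.
Proof.
move=> P0 P1 P2 P3 m; rewrite -(inord_val m).
by case: m => [[|[|[|[|]]]]].
Qed.

Lemma uniq_traject_period (T : eqType) (f : T -> T) n x :
  iter n f x = x -> x \notin traject f (f x) n.-1 -> uniq (traject f x n).
Proof.
case: n => // n per xn; rewrite looping_uniq; apply/trajectP => -[i lt_in e].
case/trajectP: xn; exists i => //.
by rewrite -iterSr iterS -e -iterS per.
Qed.

Lemma cycle_interleave (T T' : Type) (e : rel T) (e' : rel T') (P : pred T)
    (g h : T -> T') (s : seq T) :
  (forall x, P x -> e' (g x) (h x)) ->
  (forall x y, P x -> P y -> e x y -> e' (h x) (g y)) ->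
  all P s -> cycle e s -> cycle e' (flatten [seq [:: g x; h x] | x <- s]).
Proof.
move=> gh hg; case: s => //= x s /andP[Px Ps].
rewrite gh //=; have := Px; move: {1 2 4}x => y Py.
elim: s y Py Ps => [|z s IH] y Py /=; first by rewrite !andbT => _; apply: hg.
by move=> /andP[Pz Ps] /andP[yz zs]; rewrite (hg _ _ Py Pz yz) gh //= IH.
Qed.

Lemma perm_interleave (T : Type) (T' : eqType) (g h : T -> T') (s : seq T) :
  perm_eq (flatten [seq [:: g x; h x] | x <- s]) (map g s ++ map h s).
Proof.
elim: s => //= x s IH.
by rewrite perm_cons perm_sym perm_catC /= perm_cons perm_catC perm_sym.
Qed.

Section DoublePentagon.
Variable R : realType.
Local Notation phi := (phi R).

Lemma phi_sqr : phi * phi = phi + 1.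
Proof.
rewrite /Defs.phi; have := @sqr_sqrtr R 5 (ler0n _ 5).
set s := Num.sqrt 5; rewrite expr2 => h.
have -> : (1 + s) / 2 * ((1 + s) / 2) = (1 + 2 * s + s * s) / 4 by field.
by rewrite h; field.
Qed.

Lemma phi_bounds : 1 < phi < 2.
Proof.
have h0 : 0 <= phi by rewrite /Defs.phi divr_ge0 // addr_ge0 // sqrtr_ge0.
have h := phi_sqr; apply/andP; split; nra.
Qed.

(** * Coordinates of a label *)

(** The row vector p times the matrix X_m. *)
Definition mulX (m : 'I_4) (p : R * R) : R * R :=
  let: (u, w) := p in
  nth p [:: (u + phi * w, w); (phi * (u + w), u + phi * w);
            (phi * u + w, phi * (u + w)); (u, phi * u + w)] m.

(** The first row of the product of matrices of the theorem. *)
Definition coords (n : seq 'I_4) : R * R := foldr mulX (1, 0) n.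

Lemma mulX_ge0 m p : 0 <= p.1 -> 0 <= p.2 ->
  [/\ 0 <= (mulX m p).1, 0 <= (mulX m p).2
    & p.1 + p.2 <= (mulX m p).1 + (mulX m p).2].
Proof.
have /andP[f1 f2] := phi_bounds; rewrite /mulX; case: p => u w /= u0 w0.
have [hu hw] : u <= phi * u /\ w <= phi * w by split; nra.
by elim/ord4P: m; rewrite inordK //=; split; lra.
Qed.

Lemma coords_ge0 n : [/\ 0 <= (coords n).1, 0 <= (coords n).2
  & 0 < (coords n).1 + (coords n).2].
Proof.
elim: n => [|m n [u0 w0 uw0]]; first by split => /=; lra.
by have [h1 h2 h3] := mulX_ge0 m _ u0 w0; split=> //; exact: lt_le_trans h3.
Qed.

Lemma period_coords n :
  ((\prod_(m <- rev n) Xmat R m) *m const_mx (phi ^+ 2) : 'cV[R]_2) 0 0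
  = phi ^+ 2 * ((coords n).1 + (coords n).2).
Proof.
have lift01 : lift ord0 ord0 = 1 :> 'I_2 by apply: val_inj.
set M := \prod_(m <- _) _.
have [-> ->] : (coords n).1 = M 0 0 /\ (coords n).2 = M 0 1.
  rewrite /M; elim: n {M} => [|m n]; first by rewrite big_nil !mxE.
  rewrite rev_cons -cats1 big_cat /= big_seq1 /mulX.
  case: (coords n) => u w /= [-> ->]; set M := \prod_(m <- _) _.
  rewrite !mxE !big_ord_recl !big_ord0 /Xmat lift01.
  by elim/ord4P: m; rewrite inordK //= !mxE /=; split; ring.
by rewrite !mxE !big_ord_recl !big_ord0 !mxE lift01; ring.
Qed.

(** * The points alpha *)

Definition avg (x y a b : R) : R := (a * x + b * y) / (a + b).

(** The point of the boundary of weights (a, b) on the endpoints x and y: the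
    weights are homogeneous coordinates on the projective line. *)
Definition ideal_point (x y a b : R) : option R :=
  if a + b == 0 then None else Some (avg x y a b).

(** In the homogeneous coordinates attached to x and y, the reflection in the
    geodesic xy, which fixes x and y and exchanges the points (1, 1) and (1, -1)
    (the midpoint and infinity), is diagonal. *)
Lemma reflect_ideal_point (x y a b : R) : x != y -> (a != 0) || (b != 0) ->
  reflect_in x y (ideal_point x y a b) = ideal_point x y a (- b).
Proof.
rewrite /ideal_point /avg => xy ab.
have xy0 : x - y != 0 by rewrite subr_eq0.
case: (eqVneq (a + b) 0) => [/eqP|ab0].
  rewrite addr_eq0 => /eqP ea; subst a.
  have b0 : b != 0 by move: ab; rewrite oppr_eq0 orbb.
  have b2 : - b - b != 0 by rewrite -opprD oppr_eq0 -mulr2n mulrn_eq0.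
  by rewrite (negbTE b2) /=; congr Some; field.
rewrite /reflect_in.
have e : (a * x + b * y) / (a + b) - (x + y) / 2
       = (a - b) * (x - y) / (2 * (a + b)) by field.
rewrite -(subr_eq0 _ ((x + y) / 2)) e !mulf_eq0 invr_eq0 mulf_eq0 pnatr_eq0 /=.
rewrite (negbTE ab0) (negbTE xy0) !orbF.
case: (eqVneq (a - b) 0) => [//|amb].
by congr Some; field; rewrite amb ab0 xy0.
Qed.

Lemma avg_sub (x y a b a' b' : R) : a + b != 0 -> a' + b' != 0 ->
  avg x y a b - avg x y a' b'
  = (a * b' - a' * b) * (x - y) / ((a + b) * (a' + b')).
Proof. by move=> h h'; rewrite /avg; field; rewrite h h'. Qed.

Lemma avg_lt (x y a b a' b' : R) : y < x -> 0 < a + b -> 0 < a' + b' ->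
  a' * b < a * b' -> avg x y a' b' < avg x y a b.
Proof.
move=> yx h h' e; rewrite -subr_gt0 avg_sub ?gt_eqF //.
by rewrite divr_gt0 ?mulr_gt0 // subr_gt0.
Qed.

Lemma avgl (x y a : R) : a != 0 -> avg x y a 0 = x.
Proof. by move=> a0; rewrite /avg; field. Qed.

Lemma avgr (x y a : R) : a != 0 -> avg x y 0 a = y.
Proof. by move=> a0; rewrite /avg; field. Qed.

Lemma ideal_point_prop (x y a b a' b' : R) : a + b != 0 -> a' + b' != 0 ->
  a * b' = a' * b -> ideal_point x y a b = Some (avg x y a' b').
Proof.
move=> ab ab' e; rewrite /ideal_point (negbTE ab); congr Some.
by apply/eqP; rewrite -subr_eq0 avg_sub // e subrr !mul0r.
Qed.

Lemma ideal_point_gt0 (x y a b : R) :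
  0 < a + b -> ideal_point x y a b = Some (avg x y a b).
Proof. by move=> h; rewrite /ideal_point gt_eqF. Qed.

(** Change of base: the two points of weights (p1, p2) and (q1, q2) become the
    endpoints. *)
Lemma ideal_point_avg (x y p1 p2 q1 q2 a b : R) :
  p1 + p2 != 0 -> q1 + q2 != 0 ->
  ideal_point (avg x y p1 p2) (avg x y q1 q2) (a * (p1 + p2)) (b * (q1 + q2))
  = ideal_point x y (a * p1 + b * q1) (a * p2 + b * q2).
Proof.
move=> hp hq; rewrite /ideal_point.
have -> : a * (p1 + p2) + b * (q1 + q2) = a * p1 + b * q1 + (a * p2 + b * q2).
  by ring.
case: eqVneq => // h; congr Some; rewrite /avg; field.
by rewrite hp hq h.
Qed.

Lemma avg_avg (x y p1 p2 q1 q2 u w : R) : p1 + p2 != 0 -> q1 + q2 != 0 ->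
  avg (avg x y p1 p2) (avg x y q1 q2) ((p1 + p2) * u) ((q1 + q2) * w)
  = avg x y (p1 * u + q1 * w) (p2 * u + q2 * w).
Proof.
move=> hp hq; rewrite /avg; congr (_ / _); last by ring.
by field; rewrite hp hq.
Qed.

(** The weights s and t fix the projective frame.  For x = 1 - phi / 2, y = - x
    and s = t = 1 this is the pentagon of generation 0; all the other ones are
    images of it under projective maps. *)
Definition ideal_pentagon (x y s t : R) : seq (option R) :=
  [:: ideal_point x y s 0; ideal_point x y (phi * s) (- t);
      ideal_point x y s (- t); ideal_point x y s (- (phi * t));
      ideal_point x y 0 t].

Definition across (x y s t : R) : seq R :=
  [:: avg x y s 0; avg x y (phi * s) t; avg x y s t; avg x y s (phi * t);
      avg x y 0 t].

Lemma pentagon_acrossE pent (x y s t : R) : y < x -> 0 < s -> 0 < t ->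
  perm_eq pent (ideal_pentagon x y s t) ->
  pentagon_across pent x y = across x y s t.
Proof.
move=> yx s0 t0 hp; rewrite /pentagon_across.
have /andP[f1 f2] := phi_bounds.
have fs : 0 < phi * s by nra.
have ft : 0 < phi * t by nra.
have st : 0 < s * t by nra.
have fst : s * t < phi * (s * t) by nra.
have xy : x != y by rewrite gt_eqF.
have so : sorted >=%O (across x y s t).
  clear hp; rewrite /= !andbT.
  by apply/and4P; split; apply/ltW/avg_lt; lra.
rewrite -[RHS](sorted_sort ge_trans so).
apply/(perm_sortP ge_total ge_trans ge_anti).
suff -> : across x y s t = pmap (reflect_in x y) (ideal_pentagon x y s t).
  exact: perm_pmap.
clear hp so.
rewrite /= !reflect_ideal_point ?(gt_eqF s0) ?(gt_eqF t0) ?(gt_eqF fs) ?orbT //.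
rewrite oppr0 !opprK (ideal_point_prop _ _ 0 (- t) 0 t);
  rewrite ?add0r ?oppr_eq0 ?gt_eqF ?mul0r //.
by rewrite !ideal_point_gt0 //; lra.
Qed.

Lemma ideal_pentagon_avg (x y p1 p2 q1 q2 : R) :
  p1 + p2 != 0 -> q1 + q2 != 0 ->
  ideal_pentagon (avg x y p1 p2) (avg x y q1 q2) (p1 + p2) (q1 + q2)
  = [:: ideal_point x y p1 p2; ideal_point x y (phi * p1 - q1) (phi * p2 - q2);
        ideal_point x y (p1 - q1) (p2 - q2);
        ideal_point x y (p1 - phi * q1) (p2 - phi * q2);
        ideal_point x y q1 q2].
Proof.
move=> hp hq; have wE := ideal_point_avg x y p1 p2 q1 q2 _ _ hp hq.
congr [:: _; _; _; _; _].
- by have := wE 1 0; rewrite !(mul1r, mul0r, addr0).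
- by have := wE phi (- 1); rewrite !mulN1r.
- by have := wE 1 (- 1); rewrite !mulN1r !mul1r.
- by have := wE 1 (- phi); rewrite !mulNr !mul1r.
- by have := wE 0 1; rewrite !(mul1r, mul0r, add0r).
Qed.

(** The pentagon across the side is, seen from each of its four other sides,
    again of the form [ideal_pentagon], because phi^2 = phi + 1; its weights are
    those of the old one times [X_m] transposed. *)
Lemma descendE n pent (x y s t : R) : y < x -> 0 < s -> 0 < t ->
  perm_eq pent (ideal_pentagon x y s t) ->
  descend pent x y n = avg x y (s * (coords n).1) (t * (coords n).2).
Proof.
elim: n pent x y s t => [|m n IH] pent x y s t yx s0 t0 hp /=.
  by rewrite mulr1 mulr0 avgl ?gt_eqF.
rewrite (pentagon_acrossE _ _ _ _ _ yx s0 t0 hp).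
have /andP[f1 f2] := phi_bounds.
rewrite /mulX; move: {IH}(IH (map Some (across x y s t))).
case: (coords n) => u w IH.
have fs : 0 < phi * s by nra.
have ft : 0 < phi * t by nra.
have st : 0 < s * t by nra.
have fst : s * t < phi * (s * t) by nra.
clear hp.
have arc p1 p2 q1 q2 : 0 < p1 + p2 -> 0 < q1 + q2 -> q1 * p2 < p1 * q2 ->
    perm_eq (map Some (across x y s t))
      [:: ideal_point x y p1 p2;
          ideal_point x y (phi * p1 - q1) (phi * p2 - q2);
          ideal_point x y (p1 - q1) (p2 - q2);
          ideal_point x y (p1 - phi * q1) (p2 - phi * q2);
          ideal_point x y q1 q2] ->
    descend (map Some (across x y s t)) (avg x y p1 p2) (avg x y q1 q2) n
    = avg x y (p1 * u + q1 * w) (p2 * u + q2 * w).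
  move=> hp hq pq perm.
  rewrite (IH _ _ (p1 + p2) (q1 + q2)) ?avg_lt ?gt_eqF //.
    by rewrite avg_avg ?gt_eqF.
  by rewrite ideal_pentagon_avg ?gt_eqF.
have ps : phi * (phi * s) = phi * s + s by rewrite mulrA phi_sqr; ring.
have pt : phi * (phi * t) = phi * t + t by rewrite mulrA phi_sqr; ring.
have pst : phi * (phi * (s * t)) = phi * (s * t) + s * t.
  by rewrite mulrA phi_sqr; ring.
have ppst : phi * (phi * (phi * (s * t))) = 2 * phi * (s * t) + s * t.
  by rewrite pst mulrDr pst; ring.
have ss : s < phi * s by nra.
have tt : t < phi * t by nra.
(* The middle vertex must have the weights (phi s, phi t) for the two arcs that
   end there to have determinant 1 with their other endpoint. *)
have scale : avg x y s t = avg x y (phi * s) (phi * t).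
  rewrite /avg; field; rewrite !gt_eqF //; lra.
move: arc; set V := map _ _ => arc.
have rotP k (l : seq (option R)) : l = rot k (rev V) -> perm_eq V l.
  by move=> ->; rewrite perm_sym perm_rot perm_rev.
elim/ord4P: m; rewrite inordK //=.
- rewrite arc; [|lra|lra|lra|].
    by congr (avg _ _ _ _); ring.
  apply: (rotP 4); congr [:: _; _; _; _; _]; apply: ideal_point_prop;
  by [apply/eqP => e; lra | lra].
- rewrite scale arc; [|lra|lra|lra|].
    by congr (avg _ _ _ _); ring.
  apply: (rotP 3); congr [:: _; _; _; _; _]; apply: ideal_point_prop;
  by [apply/eqP => e; lra | lra].
- rewrite scale arc; [|lra|lra|lra|].
    by congr (avg _ _ _ _); ring.
  apply: (rotP 2); congr [:: _; _; _; _; _]; apply: ideal_point_prop;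
  by [apply/eqP => e; lra | lra].
- rewrite arc; [|lra|lra|lra|].
    by congr (avg _ _ _ _); ring.
  apply: (rotP 1); congr [:: _; _; _; _; _]; apply: ideal_point_prop;
  by [apply/eqP => e; lra | lra].
Qed.

Lemma alphaE n : alpha R n =
  (1 - phi / 2) * ((coords n).1 - (coords n).2) / ((coords n).1 + (coords n).2).
Proof.
have /andP[f1 f2] := phi_bounds.
rewrite /alpha (descendE _ _ _ _ 1 1) ?ltr01 //.
- by rewrite /avg !mul1r; congr (_ / _); ring.
- lra.
suff -> : pentagon0 R = ideal_pentagon (1 - phi / 2) (phi / 2 - 1) 1 1.
  exact: perm_refl.
rewrite /pentagon0 /ideal_pentagon; congr [:: _; _; _; _; _].
- by rewrite /ideal_point addr0 oner_eq0 avgl ?oner_eq0.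
- rewrite ideal_point_gt0; [congr Some|lra].
  rewrite /avg; apply: (@mulIf _ (phi * 1 - 1)).
    by rewrite gt_eqF //; lra.
  rewrite divfK; last by rewrite gt_eqF //; lra.
  by have := phi_sqr; lra.
- by rewrite /ideal_point subrr eqxx.
- rewrite /ideal_point lt_eqF; [congr Some|lra].
  rewrite /avg; apply: (@mulIf _ (1 - phi * 1)).
    by rewrite lt_eqF //; lra.
  rewrite divfK; last by rewrite lt_eqF //; lra.
  by have := phi_sqr; lra.
- by rewrite /ideal_point add0r oner_eq0 avgr ?oner_eq0.
Qed.

(** * The exchange of four intervals *)

(** A block is recorded by two flags: whether the side crossed on leaving P is 4
    (rather than 2), and whether the side crossed next is 3 (rather than the
    slanted one that can follow, 1 after 4 and 5 after 2). *)
Local Notation block := (bool * bool)%type.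
Local Notation b43 := (true, true).
Local Notation b41 := (true, false).
Local Notation b25 := (false, false).
Local Notation b23 := (false, true).

(** This is phi^2 (u + w), written linearly in u, w, phi u and phi w, as are the
    bounds and the translations below. *)
Definition width (p : R * R) : R := phi * (p.1 + p.2) + p.1 + p.2.

Definition in_zone (p : R * R) (X : block) (z : R) : bool :=
  let: (u, w) := p in
  match X with
  | b43 => 0 < z < phi * u
  | b41 => phi * u < z < phi * u + w
  | b25 => phi * u + w < z < phi * u + w + u
  | b23 => phi * u + w + u < z < width p
  end.

(** The intervals 43, 41, 25, 23 reappear in the order 41, 23, 43, 25. *)
Definition jump (p : R * R) (X : block) : R :=
  let: (u, w) := p in
  match X with
  | b43 => phi * w + w
  | b41 => - (phi * u)
  | b25 => phi * w
  | b23 => - (phi * u + u)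
  end.

Definition block_at (p : R * R) (z : R) : block :=
  (z < phi * p.1 + p.2, (z < phi * p.1) || (phi * p.1 + p.2 + p.1 < z)).

Definition exchange (p : R * R) (z : R) : R := z + jump p (block_at p z).

Lemma block_at_zone p X z : 0 <= p.1 -> 0 <= p.2 ->
  in_zone p X z -> block_at p z = X.
Proof.
case: p => u w /= u0 w0; have /andP[f1 f2] := phi_bounds.
have fu : 0 <= phi * u by nra.
rewrite /block_at /=; case: X => [[] []] /= /andP[h1 h2]; congr (_, _).
all: try (by apply/idP; lra).
all: try (by apply/negbTE; rewrite -leNgt; lra).
all: try (by apply/orP; (left; lra) || (right; lra)).
all: by apply/negbTE; rewrite negb_or -!leNgt; apply/andP; split; lra.
Qed.

(** Orbits are handled through their words: the points are determined by the
    starting point and the word, which makes them easy to substitute. *)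
Fixpoint walk p (s : seq block) z : seq R :=
  if s is X :: s' then z :: walk p s' (z + jump p X) else [::].

Fixpoint valid p (s : seq block) z : bool :=
  if s is X :: s' then in_zone p X z && valid p s' (z + jump p X) else true.

Definition sum_jump p (s : seq block) : R := \sum_(X <- s) jump p X.

Definition closed_orbit p (s : seq block) (z : R) : Prop :=
  [/\ s <> [::], valid p s z, sum_jump p s = 0 & uniq (walk p s z)].

Lemma walk_cat p s1 s2 z :
  walk p (s1 ++ s2) z = walk p s1 z ++ walk p s2 (z + sum_jump p s1).
Proof.
elim: s1 z => [|X s1 IH] z /=; first by rewrite /sum_jump big_nil addr0.
by rewrite IH /sum_jump big_cons addrA.
Qed.

Lemma valid_cat p s1 s2 z :
  valid p (s1 ++ s2) z = valid p s1 z && valid p s2 (z + sum_jump p s1).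
Proof.
elim: s1 z => [|X s1 IH] z /=; first by rewrite /sum_jump big_nil addr0.
by rewrite IH /sum_jump big_cons addrA andbA.
Qed.

Lemma walk_traject p s z : 0 <= p.1 -> 0 <= p.2 -> valid p s z ->
  [/\ walk p s z = traject (exchange p) z (size s),
      z + sum_jump p s = iter (size s) (exchange p) z
    & map (block_at p) (walk p s z) = s].
Proof.
move=> u0 w0; elim: s z => [|X s IH] z /=.
  by rewrite /sum_jump big_nil addr0.
case/andP => hX /IH[IH1 IH2 IH3].
have e : exchange p z = z + jump p X by rewrite /exchange (block_at_zone _ X).
rewrite IH1 -iterS iterSr e -IH2 /sum_jump big_cons addrA -IH1 IH3.
by rewrite (block_at_zone _ X).
Qed.

(** * Renormalisation *)

(** The blocks met by the exchange of [mulX m p] before it returns to the base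
    interval, from a point of the interval X of the exchange of p.  The columns
    for m and 3 - m correspond to each other under the symmetry of the double
    pentagon in a vertical line, which exchanges u and w, 43 and 23, 41 and 25. *)
Definition return_word (m : 'I_4) (X : block) : seq block :=
  nth [::]
    match X with
    | b43 => [:: [:: b43]; [:: b43; b25; b23];
                 [:: b25; b23; b41; b43]; [:: b41; b43; b23]]
    | b41 => [:: [:: b41; b43]; [:: b43; b23]; [:: b25; b23]; [:: b41]]
    | b25 => [:: [:: b25]; [:: b41; b43]; [:: b23; b43]; [:: b25; b23]]
    | b23 => [:: [:: b25; b23; b43]; [:: b41; b43; b25; b23];
                 [:: b23; b41; b43]; [:: b23]]
    end m.

(** The left end of the base interval, which has length [width p]. *)
Definition offset (m : 'I_4) (p : R * R) : R :=
  let: (u, w) := p in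
  nth 0 [:: phi * w + w; u + phi * w;
            phi * (phi * u + w) + phi * (u + w); phi * u] m.

(** The exchange of [mulX m p] induces on the base interval the exchange of p:
    after the return word the point has moved by the jump of p, without having
    met the base interval in between.  The last clause makes the lifts of closed
    orbits simple. *)
Lemma renorm_block m p X z : 0 <= p.1 -> 0 <= p.2 -> in_zone p X z ->
  let q := mulX m p in let t := offset m p in
  [/\ valid q (return_word m X) (z + t), sum_jump q (return_word m X) = jump p X,
      t < z + t < t + width p
    & {in behead (walk q (return_word m X) (z + t)),
        forall y, ~~ (t < y < t + width p)}].
Proof.
case: p => u w /= u0 w0; have /andP[f1 f2] := phi_bounds.
(* With these bounds and relations, everything below is linear in u, w, z and
   the products of u and w by powers of phi. *)
have hu : u <= phi * u by nra.
have hw : w <= phi * w by nra.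
have hu2 : phi * u <= u + u by nra.
have hw2 : phi * w <= w + w by nra.
have eu : phi * (phi * u) = phi * u + u by rewrite mulrA phi_sqr; ring.
have ew : phi * (phi * w) = phi * w + w by rewrite mulrA phi_sqr; ring.
have eeu : phi * (phi * (phi * u)) = phi * u + phi * u + u.
  by rewrite eu mulrDr eu; ring.
have eew : phi * (phi * (phi * w)) = phi * w + phi * w + w.
  by rewrite ew mulrDr ew; ring.
rewrite /return_word; elim/ord4P: m; rewrite inordK //; case: X => [[] []];
  rewrite /= /width /= => /andP[z1 z2].
all: split; [by rewrite ?andbT; repeat (apply/andP; split); lra
  |by rewrite /sum_jump ?big_cons big_nil /=; lra
  |by apply/andP; split; lra|].
all: apply/allP; rewrite /= ?andbT //.
all: by repeat (apply/andP; split); rewrite negb_and -!leNgt; apply/orP;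
   ((left; lra) || (right; lra)).
Qed.

Lemma return_word_neq0 m X : return_word m X <> [::].
Proof.
by rewrite /return_word; elim/ord4P: m; rewrite inordK //; case: X => [[] []].
Qed.

Definition return_words m (s : seq block) := flatten (map (return_word m) s).

Lemma renorm_walk m (p : R * R) s (z : R) :
  0 <= p.1 -> 0 <= p.2 -> valid p s z ->
  let q := mulX m p in let t := offset m p in
  [/\ valid q (return_words m s) (z + t),
      sum_jump q (return_words m s) = sum_jump p s
    & [seq y <- walk q (return_words m s) (z + t) | t < y < t + width p]
      = [seq y + t | y <- walk p s z]].
Proof.
move=> u0 w0; elim: s z => [|X s IH] z /=.
  by rewrite /sum_jump !big_nil.
set q := mulX m p; set t := offset m p.
case/andP=> /(renorm_block m p _ _ u0 w0)[v1 e1 b1 o1] /IH[v2 e2 b2].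
have zt : z + t + sum_jump q (return_word m X) = z + jump p X + t.
  by rewrite e1; ring.
rewrite /return_words /= valid_cat v1 walk_cat zt v2 filter_cat b2.
split=> //; first by rewrite /sum_jump big_cat big_cons; congr (_ + _).
move: o1 b1; rewrite -/q -/t.
case E: (return_word m X) => [|Y l] /= o1 b1.
  by have := return_word_neq0 m X; rewrite E.
rewrite b1 /=; congr (_ :: _); rewrite -[RHS]cat0s; congr (_ ++ _).
apply/eqP; rewrite -[_ == _]negbK -has_filter; apply/hasPn => y; exact: o1.
Qed.

(** The lifted orbit is a cycle of a map, so it is simple as soon as its first
    point does not come back; this point lies in the base interval, where the
    lifted orbit is a translate of the original one. *)
Lemma renorm_orbit m (p : R * R) s (z : R) :
  0 <= p.1 -> 0 <= p.2 -> closed_orbit p s z ->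
  closed_orbit (mulX m p) (return_words m s) (z + offset m p).
Proof.
move=> u0 w0 [s0 vs cs us].
have [u0' w0' _] := mulX_ge0 m p u0 w0.
have [vq cq fq] := renorm_walk m p s z u0 w0 vs.
have sq0 : return_words m s <> [::].
  by move=> e; move: fq s0; rewrite e /=; case: (s).
split=> //; first by rewrite cq.
have [eq per _] := walk_traject _ _ _ u0' w0' vq.
rewrite eq; apply: uniq_traject_period; first by rewrite -per cq cs addr0.
have inJ : z + offset m p \in [seq y + offset m p | y <- walk p s z].
  by apply: map_f; case: (s) s0 => //= X s' _; rewrite mem_head.
have : uniq [seq y + offset m p | y <- walk p s z].
  by rewrite map_inj_uniq // => a b /addIr.
move: inJ; rewrite -{}fq eq mem_filter => /andP[inJ].
by case: (size _) => //= k _; rewrite inJ /= mem_filter inJ => /andP[].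
Qed.

Lemma count_return_words X m s :
  count_mem X (return_words m s)
  = (count_mem b43 s * count_mem X (return_word m b43)
     + count_mem b41 s * count_mem X (return_word m b41)
     + count_mem b25 s * count_mem X (return_word m b25)
     + count_mem b23 s * count_mem X (return_word m b23))%N.
Proof.
elim: s => //= Y s IH; rewrite /return_words /= count_cat -/(return_words m s) IH.
by case: Y => [[] []] /=; lia.
Qed.

Lemma size_blocks (s : seq block) :
  size s = (count_mem b43 s + count_mem b41 s + count_mem b25 s
            + count_mem b23 s)%N.
Proof. by elim: s => //= [[[] []] s ->] /=; lia. Qed.

(** The intervals 25 and 41, of lengths u and w, consist of one cell of length 1
    for each visit of the orbit s and one cell of length phi for each visit of
    the orbit S.  The intervals 43 and 23 are phi times as long; as
    phi (a + phi b) = b + phi (a + b), the last three clauses say the same for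
    them. *)
Definition census (p : R * R) (s S : seq block) : Prop :=
  [/\ p.1 = (count_mem b25 s)%:R + phi * (count_mem b25 S)%:R,
      p.2 = (count_mem b41 s)%:R + phi * (count_mem b41 S)%:R,
      count_mem b43 s = count_mem b25 S /\ count_mem b23 s = count_mem b41 S,
      count_mem b43 S = (count_mem b25 s + count_mem b25 S)%N
    & count_mem b23 S = (count_mem b41 s + count_mem b41 S)%N].

Lemma census_return_words m p s S : census p s S ->
  census (mulX m p) (return_words m s) (return_words m S).
Proof.
case: p => u w [/= hu hw [a1 d1] a2 d2].
rewrite /census !count_return_words a1 a2 d1 d2 /return_word.
have sq x : phi * (phi * x) = phi * x + x by rewrite mulrA phi_sqr; ring.
have sqS := sq (count_mem b25 S)%:R; have sqT := sq (count_mem b41 S)%:R.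
rewrite /mulX {}hu {}hw; clear sq a1 a2 d1 d2.
move: (count_mem b25 s) (count_mem b25 S) (count_mem b41 s) (count_mem b41 S)
  sqS sqT => c C b B sqS sqT.
elim/ord4P: m; rewrite !inordK //=; split.
all: rewrite ?(addn0, add0n, muln0, muln1).
all: try (clear sqS sqT; first [lia | split; lia]).
all: rewrite !natrD; lra.
Qed.

Lemma two_orbits n : exists s S z Z,
  [/\ closed_orbit (coords n) s z, closed_orbit (coords n) S Z
    & census (coords n) s S].
Proof.
have /andP[f1 f2] := phi_bounds.
elim: n => [|m n [s [S [z [Z [h H c]]]]]] /=.
  (* The exchange of (1, 0) is the identity on its two intervals, ]0, phi[ and
     ]phi, phi + 1[; the starting points are their midpoints. *)
  exists [:: b25], [:: b43], (phi + 1 / 2), (phi / 2); split.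
  - by split=> //=; rewrite ?/sum_jump ?big_seq1 /= ?andbT;
      [apply/andP; split|]; lra.
  - by split=> //=; rewrite ?/sum_jump ?big_seq1 /= ?andbT;
      [apply/andP; split|]; lra.
  - by split=> //=; ring.
have [u0 w0 _] := coords_ge0 n.
exists (return_words m s), (return_words m S).
exists (z + offset m (coords n)), (Z + offset m (coords n)).
by split; [exact: renorm_orbit|exact: renorm_orbit|exact: census_return_words].
Qed.

(** * Coordinates of the pentagon *)

Local Notation sigma := (sin (pi / 5) : R).

Lemma sin_pi5_gt0 : 0 < sigma.
Proof.
apply: sin_gt0_pi; have := pi_gt0 R => h; apply/andP; split; lra.
Qed.

(** Since 2 pi/5 and 3 pi/5 are supplementary, they have the same sine, which is
    a quadratic equation for the cosine of pi/5. *)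
Lemma cos_pi5 : cos (pi / 5) = phi / 2 :> R.
Proof.
have s0 := sin_pi5_gt0.
have c0 : 0 < cos (pi / 5) :> R.
  by apply: cos_gt0_pihalf; have := pi_gt0 R => h; apply/andP; split; lra.
have s23 : sin (pi / 5 + pi / 5) = sin (pi / 5 + pi / 5 + pi / 5) :> R.
  rewrite (_ : pi / 5 + pi / 5 + pi / 5 = - (pi / 5 + pi / 5) + pi);
    last by field.
  by rewrite sinDpi sinN opprK.
have sc := cos2Dsin2 (pi / 5 : R).
rewrite !(sinD, cosD) in s23; rewrite !expr2 in sc; have f2 := phi_sqr.
move: s23 sc s0 c0; set s := sin _; set c := cos _ => s23 sc s0 c0.
have sss : s * (c * c + s * s) = s by rewrite sc mulr1.
have h : s * ((c - phi / 2) * (c + (phi - 1) / 2)) = 0.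
  rewrite (_ : _ * _ = s * (c * c - c / 2 - (phi * phi - phi) / 4));
    last by field.
  by rewrite f2; lra.
have /andP[f1 _] := phi_bounds.
move/eqP: h; rewrite !mulf_eq0 gt_eqF //= => /orP[/eqP|]; first by lra.
by rewrite gt_eqF //; lra.
Qed.

Lemma sigma_sqr : sigma * sigma = (3 - phi) / 4.
Proof.
have := cos2Dsin2 (pi / 5 : R); rewrite cos_pi5 !expr2; have := phi_sqr; lra.
Qed.

(** Up to the unit [1 / (4 sin 36°)] for the ordinates, the coordinates of the
    vertices of P lie in Q(phi). *)
Definition vx (k : nat) : R :=
  [:: - (1 / 2); 1 / 2; phi / 2; 0; - (phi / 2); - (1 / 2)]`_k.
Definition vy (k : nat) : R := [:: - phi; - phi; phi - 1; 2; phi - 1; - phi]`_k.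

Lemma vertexE b k : (k <= 5)%N ->
  vertex R b k = ((-1) ^+ b * vx k, (-1) ^+ b * (vy k / (4 * sigma))).
Proof.
have s0 := sin_pi5_gt0.
suff angle : (k <= 5)%N ->
    cos (2 * pi * k%:R / 5 - 7 * pi / 10) = 2 * sigma * vx k /\
    sin (2 * pi * k%:R / 5 - 7 * pi / 10) = vy k / 2.
  move=> /angle[]; rewrite /vertex => -> ->.
  by congr (_, _); field; rewrite gt_eqF.
have f2 := phi_sqr; have ss := sigma_sqr.
elim: k => [_|k IH k5].
  rewrite (_ : _ - _ = - (pi / 5 + pi / 2)); last by field.
  by rewrite cosN sinN cosDpihalf sinDpihalf cos_pi5 /vx /vy /=; split; lra.
have [IHc IHs] := IH (ltnW k5).
rewrite (_ : _ - _ = 2 * pi * k%:R / 5 - 7 * pi / 10 + (pi / 5 + pi / 5));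
  last by rewrite -natr1; field.
have c2 : cos (pi / 5 + pi / 5) = (phi - 1) / 2 :> R.
  by rewrite cosD cos_pi5; lra.
have s2 : sin (pi / 5 + pi / 5) = phi * sigma.
  by rewrite sinD cos_pi5; field.
clear IH; move: IHc IHs; set t := 2 * pi * _ / 5 - _ => IHc IHs.
rewrite (cosD t) (sinD t) IHc IHs c2 s2 {IHc IHs}.
have fs : sigma * (phi * phi) = sigma * (phi + 1) by rewrite f2.
have fss : phi * (sigma * sigma) = (2 * phi - 1) / 4 by rewrite ss; lra.
have ffss : phi * phi * (sigma * sigma) = (phi + 2) / 4.
  by rewrite -mulrA fss; lra.
clear t; move: k k5 => [|[|[|[|[|k]]]]] //= _; rewrite /vx /vy /=; split; lra.
Qed.

Lemma vertexN b k : vertex R (~~ b) k = - vertex R b k.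
Proof.
by rewrite /vertex; case: b; congr (_, _) => /=; rewrite ?expr0 ?expr1; ring.
Qed.

(** * From orbits of the exchange to closed trajectories *)

Section Flow.
Variables (p : R * R) (theta : R).
Hypotheses (u_ge0 : 0 <= p.1) (w_ge0 : 0 <= p.2) (uw_gt0 : 0 < p.1 + p.2).
Hypothesis sin_gt0 : 0 < sin theta.
Hypothesis theta_p :
  direction_point theta = (1 - phi / 2) * (p.1 - p.2) / (p.1 + p.2).

(** The projection to a horizontal line along the flow.  The unit of length is
    such that the sides have length phi (u + w). *)
Definition proj (q : R * R) : R :=
  phi * (p.1 + p.2) * (q.1 - q.2 * (cos theta / sin theta)).

(** The left end of the long horizontal diagonal of polygon b. *)
Definition left (b : bool) : nat := if b then 2 else 4.

Definition pos (b : bool) (q : R * R) : R := proj q - proj (vertex R b (left b)).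

(** The positions of the vertices.  Those of P' are obtained by reflection, P'
    being the image of P under a half-turn that reverses the long diagonal. *)
Definition vpos (b : bool) (k : nat) : R :=
  let d := [:: p.2; p.2 + phi * (p.1 + p.2); width p; phi * p.1 + p.2; 0; p.2]`_k
  in if b then width p - d else d.

Lemma projD q q' : proj (q + q') = proj q + proj q'.
Proof. by rewrite /proj; case: q q' => [x y] [x' y'] /=; ring. Qed.

Lemma projN q : proj (- q) = - proj q.
Proof. by rewrite /proj; case: q => [x y] /=; ring. Qed.

Lemma pos_vertex b k : (k <= 5)%N -> pos b (vertex R b k) = vpos b k.
Proof.
suff pos_vertex0 j : (j <= 5)%N -> pos false (vertex R false j) = vpos false j.
  case: b => k5; last exact: pos_vertex0.
  have := pos_vertex0 _ k5; have := pos_vertex0 2%N isT.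
  rewrite /pos /= -[true]/(~~ false) !(vertexN false) !projN /vpos /=; lra.
move=> j5; rewrite /pos -projN -projD !vertexE // !mul1r /proj /=.
have s0 := sin_pi5_gt0; have ss := sigma_sqr.
have -> : cos theta / sin theta =
    - ((1 - phi / 2) * (p.1 - p.2) / (p.1 + p.2)) / sigma.
  rewrite -theta_p /direction_point; field; rewrite !gt_eqF //.
have f2 := phi_sqr; have /andP[f1 f3] := phi_bounds.
set X := _ - _ in |- *.
have -> : phi * (p.1 + p.2) * X = phi * ((p.1 + p.2) * (vx j + phi / 2)
   + (1 - phi / 2) * (p.1 - p.2) * (vy j - (phi - 1)) / (4 * (sigma * sigma))).
  rewrite /X /vx /vy /=; field; rewrite !gt_eqF //.
(* The heights above the long diagonal are the multiples by 3 - phi, that is by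
   4 sin^2 36°, of elements of Z[phi]. *)
have -> : vy j - (phi - 1) = (3 - phi) * [:: - phi; - phi; 0; 1; 0; - phi]`_j.
  by move: j j5 {X} => [|[|[|[|[|[|j]]]]]] //= _; rewrite /vy /=; lra.
rewrite ss (_ : 4 * ((3 - phi) / 4) = 3 - phi); last by field.
have d0 : 3 - phi != 0 by rewrite gt_eqF //; lra.
rewrite [_ * (_ * _`_j)]mulrCA [_ / (3 - phi)]mulrAC divff // mul1r.
rewrite /vpos /width; clear X; move: u_ge0 w_ge0 => _ _; case: (p) => u w /=.
have sq x : phi * (phi * x) = phi * x + x by rewrite mulrA f2; ring.
have squ := sq u; have sqw := sq w.
have sqqu := sq (phi * u); have sqqw := sq (phi * w).
by move: j j5 => [|[|[|[|[|[|j]]]]]] //= _; rewrite /vx /=; lra.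
Qed.

Definition side_point (b : bool) (k : 'I_5) (z : R) : R * R :=
  let t := (z - vpos b k) / (vpos b k.+1 - vpos b k) in
  ((1 - t) * (vertex R b k).1 + t * (vertex R b k.+1).1,
   (1 - t) * (vertex R b k).2 + t * (vertex R b k.+1).2).

Definition between (x y z : R) : bool := (x < z < y) || (y < z < x).

Lemma side_point_on b (k : 'I_5) z : between (vpos b k) (vpos b k.+1) z ->
  on_open_side b k (side_point b k z).
Proof.
move=> h; exists ((z - vpos b k) / (vpos b k.+1 - vpos b k)); split=> //.
set x := vpos b k in h *; set y := vpos b k.+1 in h *.
case/orP: h => /andP[h1 h2].
  have d0 : 0 < y - x by lra.
  apply/andP; split; first by apply: divr_gt0; lra.
  by rewrite ltr_pdivrMr // mul1r; lra.
have d0 : 0 < x - y by lra.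
rewrite -mulrNN -invrN !opprB.
apply/andP; split; first by apply: divr_gt0; lra.
by rewrite ltr_pdivrMr // mul1r; lra.
Qed.

Lemma pos_side_point b (k : 'I_5) z : between (vpos b k) (vpos b k.+1) z ->
  pos b (side_point b k z) = z.
Proof.
move=> h; have d0 : vpos b k.+1 - vpos b k != 0.
  rewrite subr_eq0; apply: contraTneq h => ->.
  by rewrite /between orbb; apply/negP => /andP[h1 h2]; lra.
have k5 := ltn_ord k.
have := pos_vertex b _ k5; have := pos_vertex b _ (ltnW k5).
rewrite /pos /side_point; set t := _ / _ => hk hk1.
have -> : proj ((1 - t) * (vertex R b k).1 + t * (vertex R b k.+1).1,
    (1 - t) * (vertex R b k).2 + t * (vertex R b k.+1).2)
  = (1 - t) * proj (vertex R b k) + t * proj (vertex R b k.+1).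
  by rewrite /proj /=; ring.
have {hk} -> : proj (vertex R b k) = vpos b k + proj (vertex R b (left b)).
  by rewrite -hk; ring.
have {hk1} -> :
    proj (vertex R b k.+1) = vpos b k.+1 + proj (vertex R b (left b)).
  by rewrite -hk1; ring.
by rewrite /t; field.
Qed.

Lemma pos_glue b k q :
  pos (~~ b) (Defs.glue b k q) = pos b q + width p - vpos b k - vpos b k.+1.
Proof.
have k5 := ltn_ord k; rewrite -!pos_vertex ?(ltnW k5) //.
have -> : width p = pos b (vertex R b (left (~~ b))).
  by rewrite pos_vertex /vpos; case: (b) => //=; rewrite subr0.
by rewrite /pos /Defs.glue vertexN !(projD, projN); ring.
Qed.

(** Whether side k of polygon b lies above the long horizontal diagonal, whose
    ordinate is [level b].  An upward trajectory enters through the other sides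
    and leaves through these. *)
Definition upper (b : bool) (k : 'I_5) : bool :=
  (nat_of_ord k \in [:: 2; 3]%N) (+) b.

Definition level (b : bool) : R := (vertex R b (left b)).2.

Lemma upperN b k : upper (~~ b) k = ~~ upper b k.
Proof. by rewrite /upper; case: b; rewrite /= ?addbT ?addbF ?negbK. Qed.

Lemma side_height b k q : on_open_side b k q ->
  if upper b k then level b < q.2 else q.2 < level b.
Proof.
have k5 := ltn_ord k; have lb : (left b <= 5)%N by case: b.
case=> t [/andP[t0 t1] ->]; rewrite /upper /level !vertexE ?(ltnW k5) //=.
have -> : vy (left b) = phi - 1 by case: (b).
have s0 := sin_pi5_gt0; have /andP[f1 f2] := phi_bounds.
set S := 4 * sigma; have S0 : 0 < S by rewrite /S; lra.
have -> : (1 - t) * ((-1) ^+ b * (vy k / S)) + t * ((-1) ^+ b * (vy k.+1 / S))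
  = (-1) ^+ b * (((1 - t) * vy k + t * vy k.+1) / S) by ring.
have cmp x y :
    ((-1) ^+ b * (x / S) < (-1) ^+ b * (y / S)) = if b then y < x else x < y.
  by case: (b) => /=;
    rewrite ?expr1 ?expr0 ?mulN1r ?mul1r ?ltrN2 ltr_pM2r ?invr_gt0.
rewrite !cmp; have : if nat_of_ord k \in [:: 2; 3]%N then
   phi - 1 < (1 - t) * vy k + t * vy k.+1
   else (1 - t) * vy k + t * vy k.+1 < phi - 1.
  case: k k5 => -[|[|[|[|[|k]]]]] //= ? _; rewrite /vy /=; nra.
by case: (b); rewrite ?addbT ?addbF; case: (_ \in _).
Qed.

Lemma glue_on_open_side b k (q : R * R) :
  on_open_side b k q -> on_open_side (~~ b) k (Defs.glue b k q : R * R).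
Proof.
case=> t [/andP[t0 t1] ->]; exists (1 - t); split.
  by apply/andP; split; lra.
by rewrite /Defs.glue !vertexN; congr (_, _) => /=; ring.
Qed.

(** Two points of a polygon with the same projection along the flow lie on the
    same trajectory, and the one below the long diagonal comes first. *)
Lemma next_crossing_pos b k k' (q q' : R * R) :
  on_open_side b k q -> upper b k ->
  on_open_side (~~ b) k' q' -> upper (~~ b) k' ->
  pos (~~ b) (Defs.glue b k q) = pos (~~ b) q' ->
  next_crossing theta (b, k, q) (~~ b, k', q').
Proof.
move=> on_q up on_q' up' epos; apply/asboolP; split=> //.
  by apply: contraTneq up' => ->; rewrite upperN negbK.
have h' : level (~~ b) < q'.2 by have := side_height _ _ _ on_q'; rewrite up'.
have h : (Defs.glue b k q).2 < level (~~ b).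
  by have := side_height _ _ _ (glue_on_open_side _ _ _ on_q); rewrite upperN up.
exists ((q'.2 - (Defs.glue b k q).2) / sin theta).
  by rewrite divr_gt0 // subr_gt0 (lt_trans h).
move: epos; rewrite /pos => /addIr; rewrite /proj.
move: (Defs.glue b k q) h => g h /mulfI e.
have {}e := e _; rewrite [LHS]surjective_pairing; congr (_, _); last first.
  by rewrite /= divfK ?gt_eqF //; ring.
have -> : q'.1
    = g.1 - g.2 * (cos theta / sin theta) + q'.2 * (cos theta / sin theta).
  rewrite e; first by ring.
  rewrite mulf_neq0 ?gt_eqF //; have /andP[f1 _] := phi_bounds; lra.
by ring.
Qed.

Definition top_side (X : block) : 'I_5 :=
  if X.1 then @Ordinal 5 3 isT else @Ordinal 5 2 isT.

Definition bottom_side (X : block) : 'I_5 :=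
  if X.2 then @Ordinal 5 0 isT
  else if X.1 then @Ordinal 5 4 isT else @Ordinal 5 1 isT.

(** The passage from the long diagonal of P to that of P' through the top side of
    the block, in terms of positions (see [pos_glue]). *)
Definition half_exchange (X : block) (z : R) : R :=
  z + width p - vpos false (top_side X) - vpos false (top_side X).+1.

(** The exchange is the first return of the flow to the long diagonal of P: a
    point of the interval X projects to the top side of X, then to its bottom
    side, and comes back displaced by the jump of X. *)
Lemma block_geometry X z : in_zone p X z ->
  [/\ between (vpos false (top_side X)) (vpos false (top_side X).+1) z,
      between (vpos true (bottom_side X)) (vpos true (bottom_side X).+1)
              (half_exchange X z)
    & half_exchange X z + width p
      - vpos true (bottom_side X) - vpos true (bottom_side X).+1
      = z + jump p X].
Proof.
rewrite /between /half_exchange /vpos /in_zone /jump /width.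
have /andP[f1 f2] := phi_bounds; move: u_ge0 w_ge0.
case: (p) => u w /= u0 w0.
have fu : u <= phi * u by nra.
have fw : w <= phi * w by nra.
case: X => [[] []] /= /andP[z1 z2].
all: split; last lra.
all: apply/orP; first [by left; apply/andP; split; lra
                      |by right; apply/andP; split; lra].
Qed.

Definition first_crossing (z : R) : bool * 'I_5 * (R * R) :=
  let k := top_side (block_at p z) in (false, k, side_point false k z).

Definition second_crossing (z : R) : bool * 'I_5 * (R * R) :=
  let k := bottom_side (block_at p z) in
  (true, k, side_point true k (half_exchange (block_at p z) z)).

Definition in_some_zone (z : R) : bool := in_zone p (block_at p z) z.

Lemma first_to_second z : in_some_zone z ->
  next_crossing theta (first_crossing z) (second_crossing z).
Proof.
move=> /block_geometry[b1 b2 _]; apply: next_crossing_pos.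
- exact: side_point_on.
- by rewrite /upper /top_side; case: ifP.
- exact: side_point_on.
- by rewrite /upper /bottom_side; case: ifP => // _; case: ifP.
- by rewrite pos_glue pos_side_point // pos_side_point.
Qed.

Lemma second_to_first z : in_some_zone z -> in_some_zone (exchange p z) ->
  next_crossing theta (second_crossing z) (first_crossing (exchange p z)).
Proof.
move=> /block_geometry[b1 b2 e] /block_geometry[b3 _ _].
apply: next_crossing_pos.
- exact: side_point_on.
- by rewrite /upper /bottom_side; case: ifP => // _; case: ifP.
- exact: side_point_on.
- by rewrite /upper /top_side; case: ifP.
- by rewrite pos_glue pos_side_point // pos_side_point.
Qed.

Lemma first_crossing_inj : {in in_some_zone &, injective first_crossing}.
Proof.
move=> z z' /block_geometry[b1 _ _] /block_geometry[b2 _ _] e.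
rewrite -(pos_side_point _ _ _ b1) -(pos_side_point _ _ _ b2).
exact: (congr1 (fun c : bool * 'I_5 * (R * R) => pos false c.2) e).
Qed.

Lemma second_crossing_inj : {in in_some_zone &, injective second_crossing}.
Proof.
move=> z z' hz hz' e.
have [_ b1 _] := block_geometry _ _ hz; have [_ b2 _] := block_geometry _ _ hz'.
have {e} :
    half_exchange (block_at p z) z = half_exchange (block_at p z') z'.
  rewrite -(pos_side_point _ _ _ b1) -(pos_side_point _ _ _ b2).
  exact: (congr1 (fun c : bool * 'I_5 * (R * R) => pos true c.2) e).
move: hz hz' => {b1 b2}; rewrite !unfold_in /in_some_zone.
move: (block_at p z) (block_at p z') => X X'.
rewrite /half_exchange /vpos /in_zone /width.
have /andP[f1 f2] := phi_bounds; move: u_ge0 w_ge0.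
case: (p) => u w /= u0 w0.
have fu : u <= phi * u by nra.
have fw : w <= phi * w by nra.
by case: X => [[] []]; case: X' => [[] []] /= /andP[z1 z2] /andP[z3 z4]; lra.
Qed.

Definition sides_crossed (s : seq block) : seq (bool * 'I_5) :=
  flatten [seq [:: (false, top_side X); (true, bottom_side X)] | X <- s].

Lemma closed_orbit_trajectory s z : closed_orbit p s z ->
  exists c : seq (bool * 'I_5 * (R * R)),
    closed_trajectory theta c /\ map fst c = sides_crossed s.
Proof.
case=> s0 vs cs us; have [wt per wb] := walk_traject _ _ _ u_ge0 w_ge0 vs.
have allz : all in_some_zone (walk p s z).
  elim: s z vs {s0 cs us wt per wb} => //= X s IH z /andP[hX /IH ->].
  by rewrite /in_some_zone (block_at_zone _ X) // hX.
exists (flatten [seq [:: first_crossing y; second_crossing y] | y <- walk p s z]).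
split; last first.
  rewrite /sides_crossed -[in RHS]wb -map_comp map_flatten -map_comp.
  by congr flatten.
have cw : cycle (frel (exchange p)) (walk p s z).
  rewrite cs addr0 in per; rewrite wt; case: (size s) per => //= k per.
  rewrite (_ : rcons _ z = traject (exchange p) (exchange p z) k.+1).
    exact: fpath_traject.
  by rewrite trajectSr -iterSr iterS -per.
split.
  by case: (s) s0.
apply/andP; split.
  apply: cycle_interleave allz cw; first exact: first_to_second.
  by move=> x y Px Py /eqP e; rewrite -e in Py *; exact: second_to_first.
rewrite (perm_uniq (perm_interleave _ _ _ _ _)) cat_uniq.
rewrite !map_inj_in_uniq ?us /= ?andbT.
- by apply/hasPn => c /mapP[y _ ->]; apply/mapP => -[y' _].
- by move=> x y /(allP allz) hx /(allP allz) hy; exact: second_crossing_inj.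
- by move=> x y /(allP allz) hx /(allP allz) hy; exact: first_crossing_inj.
Qed.
End Flow.

(** * Strips and periods *)

(** Deformations keep the crossing points on their sides. *)
Lemma same_strip_sides (theta : R) (c c' : seq (bool * 'I_5 * (R * R))) :
  same_strip theta c c' -> perm_eq (map fst c) (map fst c').
Proof.
case=> i [f [_ f1 fcont _]].
have [|_] := fcont 1; first by rewrite lexx ler01.
by rewrite f1 map_rot => <-; rewrite perm_rot.
Qed.

Lemma roman_period_size (w : seq nat) N : has_roman_period w N -> size w = N.*2.
Proof.
case=> bs [sub <- [i e]]; rewrite -(size_rot i w) e.
elim: bs sub {e} => //= b bs IH sub.
rewrite size_cat IH => [|x xbs]; last by apply: sub; rewrite inE xbs orbT.
have : b \in blocks by apply: sub; rewrite mem_head.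
by rewrite !inE => /or4P[] /eqP ->; rewrite doubleS.
Qed.

Lemma size_sides (s : seq block) : size (sides_crossed s) = (size s).*2.
Proof. by rewrite /sides_crossed; elim: s => //= X s ->; rewrite doubleS. Qed.

Lemma count_horizontal_side (s : seq block) :
  count_mem (true, @Ordinal 5 0 isT) (sides_crossed s)
  = (count_mem b43 s + count_mem b23 s)%N.
Proof.
rewrite /sides_crossed; elim: s => //= X s ->; rewrite /bottom_side /top_side.
by case: X => [[] []] /=; lia.
Qed.

End DoublePentagon.

Theorem theorem4 (R : realType) (n : seq 'I_4) (theta : R) (a A : nat)
    (n_last : n = [::] \/ last ord0 n <> ord0)
    (theta_range : 0 < theta < pi)
    (theta_alpha : direction_point theta = alpha R n)
    (periods : roman_periods theta a A)
    (le_aA : (a <= A)%N) :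
  a%:R + phi R * A%:R
  = ((\prod_(m <- rev n) Xmat R m) *m const_mx (phi R ^+ 2) : 'cV[R]_2) 0 0.
Proof.
have [u0 w0 uw0] := coords_ge0 R n.
have [s [S [z [Z [orb_s orb_S cen]]]]] := two_orbits R n.
rewrite alphaE in theta_alpha; have sin0 := sin_gt0_pi theta_range.
have traj := closed_orbit_trajectory R _ theta u0 w0 uw0 sin0 theta_alpha.
have [c [cc mc]] := traj _ _ orb_s; have [C [cC mC]] := traj _ _ orb_S.
have [eu ew [e1 e2] e3 e4] := cen.
have size_s : size s = (count_mem (false, false) S + count_mem (true, false) s
    + count_mem (false, false) s + count_mem (true, false) S)%N.
  by rewrite size_blocks e1 e2.
have size_S : size S = (size s
    + (count_mem (true, false) S + count_mem (false, false) S))%N.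
  by rewrite size_blocks size_s e3 e4; lia.
have pos_uw : (0 < count_mem (false, false) s + count_mem (false, false) S
    + count_mem (true, false) s + count_mem (true, false) S)%N.
  rewrite lt0n; apply: contraTneq uw0 => /eqP; rewrite !addn_eq0 eu ew.
  move=> /andP[/andP[/andP[/eqP-> /eqP->] /eqP->] /eqP->].
  by rewrite !mulr0 !addr0 ltxx.
have periodE : (size s)%:R + phi R * (size S)%:R =
    phi R ^+ 2 * ((coords R n).1 + (coords R n).2).
  rewrite size_S size_s eu ew expr2 phi_sqr !natrD.
  have sq x : phi R * (phi R * x) = phi R * x + x by rewrite mulrA phi_sqr; ring.
  have := sq (count_mem (true, false) S)%:R.
  by have := sq (count_mem (false, false) S)%:R; lra.
(* If i blocks of s contain the letter 3 and j do not, then i + j blocks of S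
   contain it and i do not.  As i and j are not both zero, the first trajectory
   cannot cross the same sides as the second one. *)
have diff : ~ perm_eq (map fst c) (map fst C).
  rewrite mc mC => perm; have := perm_size perm; rewrite !size_sides size_S.
  move/permP: perm => /(_ (pred1 (true, @Ordinal 5 0 isT))).
  by rewrite !count_horizontal_side; lia.
case: periods => s1 [s2 [_ _ all12 /roman_period_size r1 /roman_period_size r2]].
rewrite !size_map in r1 r2; rewrite period_coords -periodE.
have size_c : size (map fst c) = (size s).*2 by rewrite mc size_sides.
have size_C : size (map fst C) = (size S).*2 by rewrite mC size_sides.
have [-> ->] : size s = a /\ size S = A; last by [].
have [/same_strip_sides p1|/same_strip_sides p1] := all12 _ cc;
have [/same_strip_sides p2|/same_strip_sides p2] := all12 _ cC.
- by case: diff; rewrite (permPl p1) perm_sym.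
- have := perm_size p1; have := perm_size p2.
  by rewrite size_c size_C !size_map r1 r2; lia.
- have := perm_size p1; have := perm_size p2.
  by rewrite size_c size_C !size_map r1 r2; lia.
- by case: diff; rewrite (permPl p1) perm_sym.
Qed.
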